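(* Let $G$ be a simple connected undirected graph with $n$ vertices. Then $$E_R(G)\ge \frac{4\,\mathcal{K}f(G)}{n},$$ and equality holds if and only if $G$ is resistance regular.
   Context: For a connected graph $G$ with vertices $v_1,\dots,v_n$, Laplacian matrix $L$ (degree matrix minus adjacency matrix) and Moore-Penrose inverse $L^\dagger=(l^\dagger_{ij})$, the resistance distance is $r_{ij}=l^\dagger_{ii}+l^\dagger_{jj}-2l^\dagger_{ij}$, and the resistance distance matrix is $R(G)=(r_{ij})_{n\times n}$. The Kirchhoff index is $\mathcal{K}f(G)=\sum_{i<j}r_{ij}$. $G$ is resistance regular if all row sums $R_i=\sum_{j=1}^n r_{ij}$ are equal. The resistance energy $E_R(G)$ is $\sum_{i=1}^n|\rho_i(G)|$, where $\rho_1(G),\dots,\rho_n(G)$ are the eigenvalues of $R(G)$ counted with multiplicity. *)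

(* Defs.v *)
From HB Require Import structures.
From mathcomp Require Import all_boot all_order all_algebra.
From mathcomp Require Import polyrcf complex.

Set Implicit Arguments.
Unset Strict Implicit.
Unset Printing Implicit Defensive.

Import Order.TTheory GRing.Theory Num.Theory.
Local Open Scope ring_scope.

(* The Moore-Penrose inverse of a real matrix, characterised by the four
   Penrose equations; [moore_penrose_uniq] shows that they determine it. *)

Definition is_moore_penrose (R : rcfType) m n
    (A : 'M[R]_(m, n)) (X : 'M[R]_(n, m)) : bool :=
  [&& A *m X *m A == A, X *m A *m X == X,
      (A *m X)^T == A *m X & (X *m A)^T == X *m A].

Lemma gram_unit (R : rcfType) r n (C : 'M[R]_(r, n)) :
  row_free C -> C *m C^T \in unitmx.
Proof.
move=> Cfree; rewrite -row_free_unit -kermx_eq0.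
apply/eqP/row_matrixP => i; rewrite row0.
set u := row i _.
have uCC : u *m (C *m C^T) = 0 by apply/sub_kermxP; apply: row_sub.
have sq : (u *m C) *m (u *m C)^T = 0.
  by rewrite trmx_mul mulmxA -[u *m C *m _]mulmxA uCC mul0mx.
have uC : u *m C = 0.
  apply/rowP => k; rewrite [RHS]mxE.
  have /eqP := congr1 (fun M : 'M[R]_1 => M 0 0) sq.
  rewrite mxE [X in _ == X]mxE psumr_eq0; last first.
    by move=> j _; rewrite [_^T _ _]mxE -expr2 sqr_ge0.
  move/allP => /(_ k (mem_index_enum _)) /=.
  by rewrite [_^T _ _]mxE mulf_eq0 orbb => /eqP.
by apply/eqP; rewrite -(mulmx_free_eq0 _ Cfree) uC.
Qed.

Lemma moore_penrose_factor (R : rcfType) m n r (B : 'M[R]_(m, r))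
    (C : 'M[R]_(r, n)) : row_full B -> row_free C ->
  is_moore_penrose (B *m C)
    (C^T *m invmx (C *m C^T) *m invmx (B^T *m B) *m B^T).
Proof.
move=> Bfull Cfree.
have uC : C *m C^T \in unitmx by apply: gram_unit.
have uB : B^T *m B \in unitmx.
  rewrite -[X in _ *m X]trmxK; apply: gram_unit.
  by rewrite /row_free mxrank_tr.
set H := invmx (C *m C^T); set K := invmx (B^T *m B).
have HT : H^T = H by rewrite trmx_inv trmx_mul trmxK.
have KT : K^T = K by rewrite trmx_inv trmx_mul trmxK.
have AX : B *m C *m (C^T *m H *m K *m B^T) = B *m K *m B^T.
  by rewrite !mulmxA -[B *m C *m C^T]mulmxA mulmxK.
have XA : (C^T *m H *m K *m B^T) *m (B *m C) = C^T *m H *m C.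
  by rewrite !mulmxA -[_ *m K *m B^T *m B]mulmxA mulmxKV.
rewrite /is_moore_penrose AX XA; apply/and4P; split; apply/eqP.
- by rewrite !mulmxA -[_ *m K *m B^T *m B]mulmxA mulmxKV.
- by rewrite !mulmxA -[_ *m H *m C *m C^T]mulmxA mulmxKV.
- by rewrite !trmx_mul trmxK KT mulmxA.
- by rewrite !trmx_mul trmxK HT mulmxA.
Qed.

Lemma moore_penrose_exists (R : rcfType) m n (A : 'M[R]_(m, n)) :
  exists X, is_moore_penrose A X.
Proof.
have := moore_penrose_factor (col_base_full A) (row_base_free A).
by rewrite mulmx_base => AX; eexists; exact: AX.
Qed.

Lemma moore_penrose_uniq (R : rcfType) m n (A : 'M[R]_(m, n)) X Y :
  is_moore_penrose A X -> is_moore_penrose A Y -> X = Y.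
Proof.
move=> /and4P[/eqP X1 /eqP X2 /eqP X3 /eqP X4].
move=> /and4P[/eqP Y1 /eqP Y2 /eqP Y3 /eqP Y4].
have AXY : A *m X = A *m Y.
  by rewrite -X3 -{1}Y1 -mulmxA trmx_mul X3 Y3 mulmxA X1.
have XYA : X *m A = Y *m A.
  by rewrite -X4 -{1}Y1 -mulmxA mulmxA trmx_mul X4 Y4 -mulmxA [A *m _]mulmxA X1.
by rewrite -X2 -mulmxA AXY mulmxA XYA.
Qed.

Definition moore_penrose (R : rcfType) m n (A : 'M[R]_(m, n)) : 'M[R]_(n, m) :=
  xchoose (moore_penrose_exists A).

Lemma moore_penroseP (R : rcfType) m n (A : 'M[R]_(m, n)) :
  is_moore_penrose A (moore_penrose A).
Proof. exact: xchooseP. Qed.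

(* The roots in R of the characteristic polynomial, repeated according to
   their multiplicity.  Only meant for matrices with a real spectrum, such as
   symmetric ones: see [char_poly_eigenvalues] and [size_eigenvalues]. *)
Definition eigenvalues (R : rcfType) n (A : 'M[R]_n) : seq R :=
  flatten [seq nseq (mup x (char_poly A)) x | x <- rootsR (char_poly A)].

Lemma char_poly_sym_split (R : rcfType) n (A : 'M[R]_n) : A^T = A ->
  exists s : seq R, char_poly A = \prod_(x <- s) ('X - x%:P).
Proof.
move=> Asym; pose toC := GRing.RMorphism.clone _ _ (real_complex R) _.
pose B : 'M[R[i]]_n := map_mx toC A.
have Bh : B \is hermsymmx.
  apply: realsym_hermsym.
    by apply/is_hermitianmxP; rewrite expr0 scale1r map_mx_id // map_trmx Asym.
  by apply/mxOverP => i j; rewrite mxE complex_real.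
have /hermitian_normalmx/orthomx_spectralP BE := Bh.
have /mxOverP Dreal := hermitian_spectral_diag_real Bh.
move: BE Dreal (spectral_unit B).
set P := spectralmx B; set D := spectral_diag B => BE Dreal Pu.
exists [seq complex.Re (D 0 i) | i <- enum 'I_n].
apply: (map_poly_inj toC).
rewrite map_char_poly -/B BE rmorph_prod big_map big_enum /=.
have -> : char_poly (invmx P *m diag_mx D *m P) = char_poly (diag_mx D).
  rewrite /char_poly /char_poly_mx !map_mxM.
  have PV : map_mx polyC (invmx P) *m map_mx polyC P = 1%:M.
    by rewrite -map_mxM mulVmx // map_mx1.
  have XE : 'X%:M = map_mx polyC (invmx P) *m 'X%:M *m map_mx polyC P
    :> 'M[{poly R[i]}]_n by rewrite mul_mx_scalar -scalemxAl PV scalemx1.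
  rewrite {1}XE -mulmxBl -mulmxBr !det_mulmx mulrAC -det_mulmx PV det1 mul1r; congr (\det _).
rewrite char_poly_trig ?diag_mx_is_trig //.
apply: eq_bigr => i _; rewrite mxE eqxx mulr1n rmorphB /= map_polyX map_polyC /=.
congr (_ - _%:P); have := Dreal 0 i.
by case: (D 0 i) => a b; rewrite complex_real /= => /eqP ->.
Qed.

Lemma char_poly_eigenvalues (R : rcfType) n (A : 'M[R]_n) : A^T = A ->
  char_poly A = \prod_(x <- eigenvalues A) ('X - x%:P).
Proof.
move=> /char_poly_sym_split[s sE]; rewrite {1}sE; apply: perm_big.
have p0 : char_poly A != 0 by rewrite monic_neq0 ?char_poly_monic.
apply/allP => x _ /=; rewrite -mu_prod_XsubC -sE /eigenvalues; apply/eqP.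
rewrite count_flatten -map_comp sumnE big_map.
under eq_bigr => y _ do rewrite /= count_nseq /=.
have [xr|xNr] := boolP (x \in rootsR (char_poly A)).
  rewrite (bigD1_seq x) ?uniq_roots //= eqxx mul1n big1 ?addn0 // => y.
  by move/negPf=> ->.
rewrite big1_seq => [|y /= yr].
  apply: mupNroot; apply: contra xNr => xr.
  have := roots_on_rootsR p0 x; rewrite xr andbT => <-; by rewrite in_itv.
by case: eqP => [yx|_]; [rewrite -yx yr in xNr|rewrite mul0n].
Qed.

Lemma size_eigenvalues (R : rcfType) n (A : 'M[R]_n) : A^T = A ->
  size (eigenvalues A) = n.
Proof.
move=> /char_poly_eigenvalues AE.
by have := size_char_poly A; rewrite {1}AE size_prod_XsubC => -[].
Qed.

(* A simple undirected graph on n vertices is a symmetric irreflexive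
   adjacency relation on 'I_n. *)

Definition connected_graph n (e : rel 'I_n) : Prop :=
  forall i j : 'I_n, connect e i j.

Definition adjacency (R : rcfType) n (e : rel 'I_n) : 'M[R]_n :=
  \matrix_(i, j) (e i j)%:R.

Definition degree n (e : rel 'I_n) (i : 'I_n) : nat := #|[set j | e i j]|.

Definition laplacian (R : rcfType) n (e : rel 'I_n) : 'M[R]_n :=
  diag_mx (\row_i (degree e i)%:R) - adjacency R e.

Definition resistance_mx (R : rcfType) n (e : rel 'I_n) : 'M[R]_n :=
  let Ld := moore_penrose (laplacian R e) in
  \matrix_(i, j) (Ld i i + Ld j j - 2 * Ld i j).

Definition kirchhoff (R : rcfType) n (e : rel 'I_n) : R :=
  \sum_(i < n) \sum_(j < n | (i < j)%N) resistance_mx R e i j.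

Definition resistance_row_sum (R : rcfType) n (e : rel 'I_n) (i : 'I_n) : R :=
  \sum_(j < n) resistance_mx R e i j.

Definition resistance_regular (R : rcfType) n (e : rel 'I_n) : Prop :=
  forall i j : 'I_n, resistance_row_sum R e i = resistance_row_sum R e j.

Definition resistance_energy (R : rcfType) n (e : rel 'I_n) : R :=
  \sum_(rho <- eigenvalues (resistance_mx R e)) `|rho|.

Lemma laplacian_sym (R : rcfType) n (e : rel 'I_n) :
  symmetric e -> (laplacian R e)^T = laplacian R e.
Proof.
move=> esym; rewrite /laplacian linearB /= tr_diag_mx; congr (_ - _).
by apply/matrixP => i j; rewrite !mxE esym.
Qed.

Lemma resistance_mx_sym (R : rcfType) n (e : rel 'I_n) :
  symmetric e -> (resistance_mx R e)^T = resistance_mx R e.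
Proof.
move=> /(laplacian_sym R) Lsym.
have Ldsym : (moore_penrose (laplacian R e))^T = moore_penrose (laplacian R e).
  have XP := moore_penroseP (laplacian R e).
  apply: (@moore_penrose_uniq _ _ _ (laplacian R e)) => //.
  move: XP; set X := moore_penrose _ => /and4P[/eqP X1 /eqP X2 /eqP X3 /eqP X4].
  apply/and4P; split; apply/eqP/trmx_inj.
  - by rewrite !trmx_mul trmxK Lsym mulmxA X1.
  - by rewrite !trmx_mul !trmxK Lsym mulmxA X2.
  - by rewrite trmxK trmx_mul trmxK Lsym -X4 trmx_mul Lsym.
  - by rewrite trmxK trmx_mul trmxK Lsym -X3 trmx_mul Lsym.
by apply/matrixP => i j; rewrite !mxE [X in X - _]addrC -{3}Ldsym mxE.
Qed.

(* Main.v *)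
Require Import Defs.
From mathcomp Require Import all_boot all_order all_algebra.
From mathcomp Require Import complex.
From mathcomp Require Import ring lra.
Import Order.TTheory GRing.Theory Num.Theory.
Local Open Scope ring_scope.

(** Write [M] for the resistance matrix, [E] for its energy, [J] for the
    all-ones matrix and [1] for the all-ones vector.  [M] is symmetric with zero
    diagonal, so its eigenvalues are real and sum to zero; hence each of them
    is at most [E / 2], and the quadratic form of [M] is at most [E / 2] times
    the squared norm ([rayleigh_le_energy]).  At [1] the form takes the value
    [2 Kf], which gives [2 Kf <= (E / 2) n].

    If equality holds, [1] only has components along eigenvectors with
    eigenvalue [E / 2], so [1] is itself an eigenvector
    ([rayleigh_eq_energy]), which says that the row sums are equal.

    Conversely, let [X] be the Moore-Penrose inverse of the Laplacian.  It is
    positive semidefinite and its rows sum to zero, so the [i]-th row sum of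
    [M] is [n X_ii + tr X] ([resistance_row_sumE]).  If the row sums are equal,
    then [X_ii = x] for all [i], and [M = 2 x J - 2 X].  Hence the eigenvalue
    of a unit eigenvector [p] is at most [2 x |<p, 1>|^2]; since the
    eigenvalues sum to zero and the numbers [|<p, 1>|^2] sum to [n], this
    bounds [E] by [4 x n = 4 Kf / n] ([energy_le_rank_one]). *)

Set Implicit Arguments.
Unset Strict Implicit.

(** * Real spectral decomposition of a symmetric matrix *)

(** [eigenframe A d a b]: the rows of [a] and [b] are the real and imaginary
    parts of an orthonormal basis of complex eigenvectors of [A], with
    eigenvalues [d].  Each row of [a] or [b] is thus a real eigenvector (or
    zero), and the 2n rows together form a Parseval frame, which serves every
    purpose of a real orthonormal basis of eigenvectors. *)
Definition eigenframe (R : rcfType) n (A : 'M[R]_n) (d : 'rV[R]_n)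
    (a b : 'M[R]_n) : Prop :=
  [/\ a *m A = diag_mx d *m a, b *m A = diag_mx d *m b,
      a^T *m a + b^T *m b = 1%:M
    & forall i, (a *m a^T) i i + (b *m b^T) i i = 1].

Lemma Re_sum (R : rcfType) (I : Type) (s : seq I) (F : I -> R[i]) :
  complex.Re (\sum_(i <- s) F i) = \sum_(i <- s) complex.Re (F i).
Proof. by elim/big_rec2: _ => // i _ y _ <-; case: (F i) y => ? ? []. Qed.

Lemma Im_sum (R : rcfType) (I : Type) (s : seq I) (F : I -> R[i]) :
  complex.Im (\sum_(i <- s) F i) = \sum_(i <- s) complex.Im (F i).
Proof. by elim/big_rec2: _ => // i _ y _ <-; case: (F i) y => ? ? []. Qed.

Lemma ReMr (R : rcfType) (x : R[i]) (r : R) :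
  complex.Re (x * r%:C%C) = complex.Re x * r.
Proof. by case: x => y z /=; rewrite mulr0 subr0. Qed.

Lemma ImMr (R : rcfType) (x : R[i]) (r : R) :
  complex.Im (x * r%:C%C) = complex.Im x * r.
Proof. by case: x => y z /=; rewrite mulr0 add0r. Qed.

Lemma char_poly_unit_conj (F : fieldType) n (P A B : 'M[F]_n) :
  P \in unitmx -> P *m A = B *m P -> char_poly A = char_poly B.
Proof.
move=> Pu PA; have uPP : map_mx polyC P \in unitmx.
  by rewrite unitmxE det_map_mx rmorph_unit // -unitmxE.
have E : map_mx polyC P *m char_poly_mx A = char_poly_mx B *m map_mx polyC P.
  by rewrite /char_poly_mx mulmxBr mulmxBl -!map_mxM PA scalar_mxC.
have /(congr1 determinant) := E.
rewrite !det_mulmx mulrC => /mulIf; apply.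
by move: uPP; rewrite unitmxE; apply: contraTneq => ->; rewrite unitr0.
Qed.

(** Complexify, diagonalize by a unitary matrix, and separate the real and
    imaginary parts of the resulting identities. *)
Lemma symmetric_eigenframe (R : rcfType) n (A : 'M[R]_n) : A^T = A ->
  exists d a b, eigenframe A d a b
    /\ perm_eq (eigenvalues A) [seq d 0 i | i <- enum 'I_n].
Proof.
move=> Asym; pose toC := GRing.RMorphism.clone _ _ (real_complex R) _.
pose B : 'M[R[i]]_n := map_mx toC A.
have Bh : B \is hermsymmx.
  apply: realsym_hermsym.
    by apply/is_hermitianmxP; rewrite expr0 scale1r map_mx_id // map_trmx Asym.
  by apply/mxOverP => i j; rewrite mxE complex_real.
have /hermitian_normalmx/orthomx_spectralP BE := Bh.
have /mxOverP Dreal := hermitian_spectral_diag_real Bh.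
move: BE Dreal (spectral_unitarymx B).
set P := spectralmx B; set D := spectral_diag B => BE Dreal Pun.
have Pu := unitarymx_unit Pun.
pose d := \row_i complex.Re (D 0 i).
have DE : D = map_mx toC d.
  apply/rowP => i; rewrite !mxE; have := Dreal 0 i.
  by case: (D 0 i) => x y; rewrite complex_real => /eqP ->.
have PB : P *m B = diag_mx D *m P by rewrite BE !mulmxA mulmxV // mul1mx.
have PP : P *m (map_mx Num.conj P^T) = 1%:M by apply/unitarymxP.
have PP' : (map_mx Num.conj P^T) *m P = 1%:M by apply: mulmx1C.
have PBE i j : \sum_k P i k * toC (A k j) = P i j * toC (d 0 i).
  have /matrixP/(_ i j) := PB; rewrite DE mul_diag_mx !mxE mulrC => <-.
  by apply: eq_bigr => k _; rewrite mxE.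
exists d, (map_mx (@complex.Re R) P), (map_mx (@complex.Im R) P); split.
  split.
  - apply/matrixP => i j; rewrite mul_diag_mx !mxE.
    have := congr1 (@complex.Re R) (PBE i j).
    rewrite Re_sum ReMr mxE mulrC => <-.
    by apply: eq_bigr => k _; rewrite mxE ReMr.
  - apply/matrixP => i j; rewrite mul_diag_mx !mxE.
    have := congr1 (@complex.Im R) (PBE i j).
    rewrite Im_sum ImMr mxE mulrC => <-.
    by apply: eq_bigr => k _; rewrite mxE ImMr.
  - apply/matrixP => i j; rewrite !mxE -big_split /=.
    have /matrixP/(_ i j)/(congr1 (@complex.Re R)) := PP'.
    rewrite !mxE Re_sum [RHS](_ : _ = (i == j)%:R); last by case: (i == j).
    move=> <-; apply: eq_bigr => k _; rewrite !mxE.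
    by case: (P k i) (P k j) => x y [z t] /=; ring.
  - move=> i; rewrite !mxE -big_split /=.
    have /matrixP/(_ i i)/(congr1 (@complex.Re R)) := PP.
    rewrite !mxE eqxx Re_sum /= => <-; apply: eq_bigr => k _; rewrite !mxE.
    by case: (P i k) => x y /=; ring.
apply: prod_XsubC_eq; rewrite -char_poly_eigenvalues // big_map big_enum /=.
apply: (map_poly_inj toC).
rewrite map_char_poly -/B (char_poly_unit_conj Pu PB).
rewrite char_poly_trig ?diag_mx_is_trig // rmorph_prod /=.
apply: eq_bigr => i _; rewrite DE !mxE eqxx mulr1n.
by rewrite rmorphB /= map_polyX map_polyC.
Qed.

(** * Energy of symmetric matrices of trace zero *)

(** Sum of the moduli of the eigenvalues; meant for symmetric matrices, as
    [eigenvalues] only lists the eigenvalues lying in [R]. *)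
Definition mx_energy (R : rcfType) n (A : 'M[R]_n) : R :=
  \sum_(rho <- eigenvalues A) `|rho|.

(** The squared modulus of the coordinate of [u] along the [i]-th vector of
    the complex eigenbasis with real part [a] and imaginary part [b]. *)
Definition frame_weight (R : rcfType) n (a b : 'M[R]_n) (u : 'cV[R]_n)
    (i : 'I_n) : R :=
  (a *m u) i 0 ^+ 2 + (b *m u) i 0 ^+ 2.

Lemma frame_weight_ge0 (R : rcfType) n (a b : 'M[R]_n) u i :
  0 <= frame_weight a b u i.
Proof. by rewrite addr_ge0 ?sqr_ge0. Qed.

Lemma congruence_diag_quadratic (R : rcfType) m n (a : 'M[R]_(m, n))
    (d : 'rV[R]_m) (u : 'cV[R]_n) :
  (u^T *m (a^T *m diag_mx d *m a) *m u) 0 0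
    = \sum_i d 0 i * (a *m u) i 0 ^+ 2.
Proof.
have -> : u^T *m (a^T *m diag_mx d *m a) *m u
    = (a *m u)^T *m (diag_mx d *m (a *m u)) by rewrite trmx_mul !mulmxA.
rewrite mul_diag_mx; move: (a *m u) => v; rewrite mxE.
by apply: eq_bigr => i _; rewrite !mxE; ring.
Qed.

Section Frame.
Context (R : rcfType) (n : nat) (A : 'M[R]_n) (d : 'rV[R]_n) (a b : 'M[R]_n).
Context (F : eigenframe A d a b).

Lemma frame_decomposition :
  A = a^T *m diag_mx d *m a + b^T *m diag_mx d *m b.
Proof.
case: F => aA bA ab _.
by rewrite -!mulmxA -aA -bA !mulmxA -mulmxDl ab mul1mx.
Qed.

Lemma frame_quadratic u :
  (u^T *m A *m u) 0 0 = \sum_i d 0 i * frame_weight a b u i.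
Proof.
rewrite frame_decomposition mulmxDr mulmxDl mxE !congruence_diag_quadratic.
by rewrite -big_split /=; apply: eq_bigr => i _; rewrite mulrDr.
Qed.

Lemma frame_parseval u :
  (u^T *m u) 0 0 = \sum_i frame_weight a b u i.
Proof.
case: F => _ _ ab _; rewrite -[X in X *m u]mulmx1 -ab.
rewrite -[a^T]mulmx1 -[b^T]mulmx1 -diag_const_mx.
rewrite mulmxDr mulmxDl mxE !congruence_diag_quadratic -big_split /=.
by apply: eq_bigr => i _; rewrite ![const_mx _ _ _]mxE !mul1r.
Qed.

Lemma frame_trace : \tr A = \sum_i d 0 i.
Proof.
case: F => _ _ _ n1; rewrite frame_decomposition mxtraceD.
rewrite -!mulmxA [\tr (a^T *m _)]mxtrace_mulC [\tr (b^T *m _)]mxtrace_mulC.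
rewrite -!mulmxA !mul_diag_mx -big_split /=.
by apply: eq_bigr => i _; rewrite ![(\matrix_(_, _) _) i i]mxE -mulrDr n1 mulr1.
Qed.

Lemma frame_eigenvalue i :
  d 0 i = (row i a *m A *m (row i a)^T) 0 0
        + (row i b *m A *m (row i b)^T) 0 0.
Proof.
case: F => aA bA _ n1; rewrite -!row_mul aA bA !mul_diag_mx.
rewrite -[LHS]mulr1 -(n1 i) mulrDr !mxE !mulr_sumr.
by congr (_ + _); apply: eq_bigr => k _; rewrite !mxE mulrA.
Qed.

End Frame.

Lemma mx_energy_frame (R : rcfType) n (A : 'M[R]_n) (d : 'rV[R]_n) :
  perm_eq (eigenvalues A) [seq d 0 i | i <- enum 'I_n] ->
  mx_energy A = \sum_i `|d 0 i|.
Proof. by move=> dE; rewrite /mx_energy (perm_big _ dE) big_map big_enum. Qed.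

(** If reals sum to zero, each is at most half the sum of their moduli. *)
Lemma le_half_sum_norm (R : realFieldType) (I : finType) (d : I -> R) i :
  \sum_j d j = 0 -> 2 * d i <= \sum_j `|d j|.
Proof.
rewrite (bigD1 i) //= [X in _ <= X](bigD1 i) //= => /eqP.
rewrite addr_eq0 => /eqP di.
have : d i <= \sum_(j | j != i) `|d j|.
  by rewrite di -sumrN; apply: ler_sum => j _; rewrite -normrN ler_norm.
have := ler_norm (d i); lra.
Qed.

Lemma rayleigh_le_energy (R : rcfType) n (A : 'M[R]_n) (u : 'cV[R]_n) :
  A^T = A -> \tr A = 0 ->
  2 * (u^T *m A *m u) 0 0 <= mx_energy A * (u^T *m u) 0 0.
Proof.
move=> /symmetric_eigenframe[d [a [b [F dE]]]].
rewrite (frame_trace F) (frame_quadratic F) (frame_parseval F) => d0.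
rewrite (mx_energy_frame dE) !mulr_sumr; apply: ler_sum => i _.
by rewrite mulrA ler_wpM2r ?frame_weight_ge0 // le_half_sum_norm.
Qed.

(** Equality forces [u] to be supported on the eigenvectors whose eigenvalue
    is half the energy, so that it is itself such an eigenvector. *)
Lemma rayleigh_eq_energy (R : rcfType) n (A : 'M[R]_n) (u : 'cV[R]_n) :
  A^T = A -> \tr A = 0 ->
  2 * (u^T *m A *m u) 0 0 = mx_energy A * (u^T *m u) 0 0 ->
  A *m u = (mx_energy A / 2) *: u.
Proof.
move=> /symmetric_eigenframe[d [a [b [F dE]]]].
rewrite (frame_trace F) (frame_quadratic F) (frame_parseval F) => d0.
set E := mx_energy A => eqE.
have gap_ge0 i : 0 <= (E - 2 * d 0 i) * frame_weight a b u i.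
  rewrite mulr_ge0 ?frame_weight_ge0 // subr_ge0 /E (mx_energy_frame dE).
  exact: le_half_sum_norm.
have gap0 i : (E - 2 * d 0 i) * frame_weight a b u i = 0.
  have /psumr_eq0P : \sum_i (E - 2 * d 0 i) * frame_weight a b u i = 0.
    under eq_bigr => j _ do rewrite mulrBl -mulrA.
    by rewrite sumrB -!mulr_sumr eqE subrr.
  by apply.
have scale (v : R) i : v ^+ 2 <= frame_weight a b u i -> d 0 i * v = E / 2 * v.
  move=> vw; have /eqP := gap0 i; rewrite mulf_eq0 => /orP[/eqP dEi|/eqP w0].
    by congr (_ * _); lra.
  move: vw; rewrite w0 => v0.
  have /eqP : v ^+ 2 = 0 by apply/eqP; rewrite eq_le v0 sqr_ge0.
  by rewrite sqrf_eq0 => /eqP ->; rewrite !mulr0.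
have au : diag_mx d *m (a *m u) = (E / 2) *: (a *m u).
  apply/colP => i; rewrite mul_diag_mx mxE [RHS]mxE scale //.
  by rewrite /frame_weight lerDl sqr_ge0.
have bu : diag_mx d *m (b *m u) = (E / 2) *: (b *m u).
  apply/colP => i; rewrite mul_diag_mx mxE [RHS]mxE scale //.
  by rewrite /frame_weight lerDr sqr_ge0.
rewrite {1}(frame_decomposition F) mulmxDl -!mulmxA au bu -!scalemxAr -scalerDr.
by case: F => _ _ ab _; rewrite !mulmxA -mulmxDl ab mul1mx.
Qed.

(** Subtracting a positive semidefinite matrix from [c *: (u *m u^T)] leaves
    the [i]-th eigenvalue at most [c] times the squared [i]-th coordinate of
    [u]; as the trace vanishes, this bounds the sum of the moduli. *)
Lemma energy_le_rank_one (R : rcfType) n (A G : 'M[R]_n) (u : 'cV[R]_n) c :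
  A^T = A -> \tr A = 0 -> 0 <= c ->
  (forall v : 'rV[R]_n, 0 <= (v *m G *m v^T) 0 0) ->
  A = c *: (u *m u^T) - G ->
  mx_energy A <= 2 * c * (u^T *m u) 0 0.
Proof.
move=> /symmetric_eigenframe[d [a [b [F dE]]]].
rewrite (frame_trace F) (frame_parseval F) (mx_energy_frame dE) => d0 c0 G0 AE.
have quad (m : 'M[R]_n) i :
    (row i m *m A *m (row i m)^T) 0 0 <= c * (m *m u) i 0 ^+ 2.
  have uu : (row i m *m (u *m u^T) *m (row i m)^T) 0 0 = (m *m u) i 0 ^+ 2.
    rewrite mulmxA -mulmxA -trmx_mul -(row_mul i m u).
    by move: (m *m u) => w; rewrite mxE big_ord1 !mxE.
  rewrite AE mulmxBr mulmxBl -scalemxAr -scalemxAl -uu.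
  move: (_ *m (u *m u^T) *m _) (_ *m G *m _) (G0 (row i m)) => t s s0.
  by rewrite !mxE gerBl.
have dle i : d 0 i <= c * frame_weight a b u i.
  by rewrite (frame_eigenvalue F) mulrDr lerD.
have -> : \sum_i `|d 0 i| = \sum_i (`|d 0 i| + d 0 i).
  by rewrite big_split /= d0 addr0.
rewrite mulr_sumr; apply: ler_sum => i _.
have := dle i; have := mulr_ge0 c0 (frame_weight_ge0 a b u i).
by rewrite -mulrA; case: (ger0P (d 0 i)) => di; lra.
Qed.

(** * The Laplacian and its Moore-Penrose inverse *)

(** The Moore-Penrose inverse commutes with transposition. *)
Lemma is_moore_penrose_tr (R : rcfType) m n (A : 'M[R]_(m, n)) X :
  is_moore_penrose A X -> is_moore_penrose A^T X^T.
Proof.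
move=> /and4P[/eqP X1 /eqP X2 /eqP X3 /eqP X4].
apply/and4P; split; apply/eqP.
- by rewrite -!trmx_mul mulmxA X1.
- by rewrite -!trmx_mul mulmxA X2.
- by rewrite -trmx_mul X4.
- by rewrite -trmx_mul X3.
Qed.

Lemma moore_penrose_sym (R : rcfType) n (A : 'M[R]_n) :
  A^T = A -> (moore_penrose A)^T = moore_penrose A.
Proof.
move=> As; apply: (@moore_penrose_uniq _ _ _ A); last exact: moore_penroseP.
by rewrite -{1}As; apply/is_moore_penrose_tr/moore_penroseP.
Qed.

(** Holds because a symmetric matrix commutes with its Moore-Penrose
    inverse. *)
Lemma moore_penrose_ker (R : rcfType) n p (A : 'M[R]_n) (u : 'M[R]_(n, p)) :
  A^T = A -> A *m u = 0 -> moore_penrose A *m u = 0.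
Proof.
move=> As Au; have Xs := moore_penrose_sym As.
have /and4P[_ /eqP X2 /eqP X3 _] := moore_penroseP A.
move: X3; rewrite trmx_mul Xs As => X3.
by rewrite -X2 -[_ *m A *m _]mulmxA -X3 -!mulmxA Au !mulmx0.
Qed.

(** For symmetric [A] with Moore-Penrose inverse [X], one has
    [X = X A X = X A X^T]. *)
Lemma moore_penrose_psd (R : rcfType) n (A : 'M[R]_n) :
  A^T = A -> (forall v : 'rV[R]_n, 0 <= (v *m A *m v^T) 0 0) ->
  forall v : 'rV[R]_n, 0 <= (v *m moore_penrose A *m v^T) 0 0.
Proof.
move=> As A0 v; have Xs := moore_penrose_sym As.
have /and4P[_ /eqP X2 _ _] := moore_penroseP A.
have := A0 (v *m moore_penrose A).
by rewrite trmx_mul Xs mulmxA -2!(mulmxA v) X2.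
Qed.

Lemma mulmx_const1 (R : rcfType) m n (A : 'M[R]_(m, n)) i :
  (A *m const_mx 1 :> 'cV_m) i 0 = \sum_j A i j.
Proof. by rewrite mxE; apply: eq_bigr => j _; rewrite mxE mulr1. Qed.

Lemma laplacian_const (R : rcfType) n (e : rel 'I_n) :
  laplacian R e *m const_mx 1 = 0 :> 'cV[R]_n.
Proof.
apply/colP => i; rewrite mulmxBl mul_diag_mx !mxE mulr1 /degree.
under eq_bigr => j _ do rewrite !mxE mulr1.
by rewrite -natr_sum -sum1dep_card big_mkcond subrr.
Qed.

(** The quadratic form of the Laplacian is half the sum of
    [(v i - v j) ^+ 2] over ordered pairs of adjacent vertices. *)
Lemma laplacian_psd (R : rcfType) n (e : rel 'I_n) (v : 'rV[R]_n) :
  symmetric e -> 0 <= (v *m laplacian R e *m v^T) 0 0.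
Proof.
move=> esym; pose w i j : R := (e i j)%:R.
have degE i : (degree e i)%:R = \sum_j w i j.
  by rewrite -natr_sum /degree -sum1dep_card big_mkcond.
have LE : (v *m laplacian R e *m v^T) 0 0
    = \sum_i \sum_j w i j * (v 0 i ^+ 2 - v 0 i * v 0 j).
  rewrite -mulmxA mxE; apply: eq_bigr => i _.
  rewrite mulmxBl mul_diag_mx !mxE degE mulrBr !mulr_suml !mulr_sumr -sumrB.
  by apply: eq_bigr => j _; rewrite !mxE /w; ring.
have swap : \sum_i \sum_j w i j * (v 0 i ^+ 2 - v 0 i * v 0 j)
    = \sum_i \sum_j w i j * (v 0 j ^+ 2 - v 0 i * v 0 j).
  rewrite exchange_big; apply: eq_bigr => i _; apply: eq_bigr => j _.
  by rewrite /w esym [v 0 j * _]mulrC.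
have : 0 <= \sum_i \sum_j w i j * (v 0 i - v 0 j) ^+ 2.
  apply: sumr_ge0 => i _; apply: sumr_ge0 => j _.
  by rewrite mulr_ge0 ?sqr_ge0 ?ler0n.
have -> : \sum_i \sum_j w i j * (v 0 i - v 0 j) ^+ 2
    = 2 * (v *m laplacian R e *m v^T) 0 0.
  rewrite mulr_natl mulr2n {1}LE LE {2}swap -big_split /=.
  apply: eq_bigr => i _; rewrite -big_split /=; apply: eq_bigr => j _; ring.
by rewrite pmulr_rge0 ?ltr0n.
Qed.

(** * The resistance matrix *)

Section Resistance.
Context (R : rcfType) (n : nat) (e : rel 'I_n) (esym : symmetric e).
Let X := moore_penrose (laplacian R e).
Let one : 'cV[R]_n := const_mx 1.

Lemma resistance_mx_trace0 : \tr (resistance_mx R e) = 0.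
Proof. by apply: big1 => i _; rewrite mxE; ring. Qed.

(** The off-diagonal terms cancel because the rows of the Moore-Penrose
    inverse sum to zero. *)
Lemma resistance_row_sumE i :
  resistance_row_sum R e i = n%:R * X i i + \tr X.
Proof.
rewrite /resistance_row_sum; under eq_bigr => j _ do rewrite mxE -/X.
rewrite sumrB big_split /= sumr_const card_ord -mulr_sumr mulr_natl.
have := moore_penrose_ker (laplacian_sym R esym) (laplacian_const R e).
move=> /colP/(_ i); rewrite mulmx_const1 mxE -/X => ->.
by rewrite mul0rn subr0 mulr_natl.
Qed.

Lemma resistance_mx_one i :
  (resistance_mx R e *m one) i 0 = resistance_row_sum R e i.
Proof. exact: mulmx_const1. Qed.

Lemma resistance_total :
  (one^T *m resistance_mx R e *m one) 0 0 = 2 * kirchhoff R e.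
Proof.
rewrite -mulmxA mxE mulr_natl mulr2n.
under eq_bigr => i _ do rewrite resistance_mx_one !mxE mul1r.
rewrite {1}/kirchhoff /resistance_row_sum.
under eq_bigr => i _ do rewrite (bigID (fun j : 'I_n => (i < j)%N)) /=.
rewrite big_split /=; congr (_ + _).
(* The pairs with [j <= i], transposed, are the pairs with [i < j] together
   with the diagonal, where the resistance vanishes. *)
rewrite (exchange_big_dep predT) //=; apply: eq_bigr => i _.
have rs j k : resistance_mx R e j k = resistance_mx R e k j.
  by rewrite -[in LHS](resistance_mx_sym R esym) mxE.
rewrite (bigD1 i) ?ltnn //= [X in X + _]mxE.
rewrite [X in X + _](_ : _ = 0) ?add0r; last ring.
apply: eq_big => [j|j _]; last exact: rs.
by rewrite -leqNgt ltn_neqAle andbC eq_sym.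
Qed.

Lemma sqnorm_one : (one^T *m one) 0 0 = n%:R.
Proof.
rewrite mxE; under eq_bigr => i _ do rewrite !mxE mulr1.
by rewrite sumr_const card_ord.
Qed.

(** For a resistance-regular graph all diagonal entries of the Moore-Penrose
    inverse coincide, so that the resistance matrix is a multiple of the
    all-ones matrix minus a positive semidefinite matrix. *)
Lemma resistance_regular_energy : (0 < n)%N -> resistance_regular R e ->
  mx_energy (resistance_mx R e) <= 4 * kirchhoff R e / n%:R.
Proof.
move=> n_gt0 reg; pose i0 := Ordinal n_gt0; pose x := X i0 i0.
have n0 : n%:R != 0 :> R by rewrite pnatr_eq0 -lt0n.
have Xpsd : forall v : 'rV[R]_n, 0 <= (v *m X *m v^T) 0 0.
  apply: moore_penrose_psd (laplacian_sym R esym) _ => v.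
  exact: laplacian_psd.
have Xdiag i : X i i = x.
  have := reg i i0; rewrite !resistance_row_sumE => /addIr.
  exact: mulfI.
have x_ge0 : 0 <= x.
  have := Xpsd (delta_mx 0 i0).
  by rewrite -rowE trmx_delta -colE !mxE.
have RE : resistance_mx R e = (2 * x) *: (one *m one^T) - 2 *: X.
  apply/matrixP => i j; rewrite mxE -/X !Xdiag !mxE big_ord1 !mxE; ring.
have sumc (c : R) : \sum_(i < n) c = n%:R * c.
  by rewrite sumr_const card_ord mulr_natl.
have kf : kirchhoff R e = n%:R ^+ 2 * x.
  have : 2 * kirchhoff R e = 2 * (n%:R ^+ 2 * x).
    rewrite -resistance_total -mulmxA mxE.
    under eq_bigr => i _ do rewrite resistance_mx_one resistance_row_sumE Xdiag
      mxE mxE mul1r /mxtrace (eq_bigr (fun=> x)) //.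
    by rewrite !sumc; ring.
  by apply: mulfI; rewrite pnatr_eq0.
have := energy_le_rank_one (resistance_mx_sym R esym) resistance_mx_trace0
  (mulr_ge0 (ler0n _ 2) x_ge0) _ RE.
rewrite sqnorm_one kf => /(_ _)/le_trans; apply.
  by move=> v; rewrite -scalemxAr -scalemxAl mxE mulr_ge0.
by rewrite le_eqVlt; apply/orP; left; apply/eqP; field.
Qed.

End Resistance.

Unset Implicit Arguments.

Theorem proposition4p2 (R : rcfType) (n : nat) (e : rel 'I_n)
    (hn : (0 < n)%N) (hsym : symmetric e) (hirr : irreflexive e)
    (hconn : connected_graph e) :
  4 * kirchhoff R e / n%:R <= resistance_energy R e
  /\ (resistance_energy R e = 4 * kirchhoff R e / n%:R
      <-> resistance_regular R e).
Proof.
have n_gt0 : 0 < n%:R :> R by rewrite ltr0n.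
have n0 : n%:R != 0 :> R by rewrite gt_eqF.
have sym := resistance_mx_sym R hsym.
have tr0 := resistance_mx_trace0 R e.
have kf4 : 4 * kirchhoff R e = 2 * (2 * kirchhoff R e) by ring.
have lower : 4 * kirchhoff R e / n%:R <= resistance_energy R e.
  rewrite ler_pdivrMr // kf4 -resistance_total // -[n%:R]sqnorm_one.
  exact: rayleigh_le_energy.
split=> //; split=> [eqE i j|reg]; last first.
  by apply/eqP; rewrite eq_le lower resistance_regular_energy.
have eig : resistance_mx R e *m const_mx 1
    = (resistance_energy R e / 2) *: const_mx 1 :> 'cV[R]_n.
  apply: rayleigh_eq_energy => //; rewrite resistance_total // sqnorm_one.
  by rewrite -kf4 -[mx_energy _]/(resistance_energy R e) eqE divfK.
by rewrite -!resistance_mx_one eig !mxE.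
Qed.
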